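(* Let $D\ge 1$ be an integer, $p\ge 1$, and let $m,n,V>0$ be real numbers with $n\ge m$ and such that $mV$ and $nV$ are positive integers. Let $$R=\frac{\left(\Gamma\left(\frac{D}{p}+1\right)\right)^{1/D}}{2\,\Gamma\left(\frac1p+1\right)},$$ and define $$\hat{\mathbb{E}}[X]=\frac{R}{m\,n^{1/D}\,V}\left[1+\sum_{i=2}^{mV}\left(\frac{nV}{i-1}-1\right)\operatorname{Li}_{-1/D}\left(\frac{i-1}{nV}\right)\right].$$ Then $$\frac{R}{m\,n^{\frac1D-1}}\int_0^{\frac mn-\frac1{nV}}\left(\frac1x-1\right)\operatorname{Li}_{-1/D}(x)\,dx\;\le\;\hat{\mathbb{E}}[X]\;\le\;\frac{R}{m\,n^{\frac1D-1}}\int_0^{\frac mn}\left(\frac1x-1\right)\operatorname{Li}_{-1/D}(x)\,dx .$$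
   Context: $\operatorname{Li}_s(x)=\sum_{k=1}^{\infty}x^k/k^s$ (for $0\le x<1$) is the poly-logarithm and $\Gamma$ is the gamma function. The integrands are positive; at $x=0$ the function $\left(\frac1x-1\right)\operatorname{Li}_{-1/D}(x)$ is understood through its limit $1$. When $m=n$ the upper bound is an improper integral at $x=1$ and is read as an element of $(0,+\infty]$. An empty sum (when $mV=1$) equals $0$. Background (not needed for the statement): $m$ and $n$ are the densities of demand and supply vertices, uniformly distributed in a hyper-ball of volume $V$ in a $D$-dimensional $L^p$ space, so $mV$ and $nV$ are the numbers of vertices; $R$ is the radius of the unit-volume hyper-ball; $\hat{\mathbb{E}}[X]$ is a closed-form approximation of the expected optimal bipartite matching distance per demand vertex. *)

(* Defs.v *)
From HB Require Import structures.
From mathcomp Require Import all_boot all_order all_algebra.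
From mathcomp Require Import all_classical all_reals all_analysis.
Set Implicit Arguments.
Unset Strict Implicit.
Unset Printing Implicit Defensive.
Import Order.TTheory GRing.Theory Num.Theory.
Import numFieldNormedType.Exports.
Local Open Scope classical_set_scope.
Local Open Scope ring_scope.

(* Euler's integral; meaningful for 0 < z, where the integral is finite. *)
Definition Gamma (R : realType) (z : R) : R :=
  (\int[@lebesgue_measure R]_(t in `]0, +oo[) (t `^ (z - 1) * expR (- t)))%R.

(* Only meaningful where the series converges, in particular for 0 <= x < 1. *)
Definition polylog (R : realType) (s x : R) : R :=
  limn (fun N : nat => \sum_(1 <= k < N) x ^+ k / k%:R `^ s).

(* Extended at 0 by its limit 1; not meaningful at x = 1 when polylog
   diverges, so integrals up to 1 are to be taken over [0, 1[. *)
Definition integrand (R : realType) (D : nat) (x : R) : R :=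
  if x == 0 then 1 else (x^-1 - 1) * polylog (- D%:R^-1) x.

(* Radius of the unit-volume ball of the D-dimensional L^p space. *)
Definition unit_ball_radius (R : realType) (D : nat) (p : R) : R :=
  Gamma (D%:R / p + 1) `^ D%:R^-1 / (2 * Gamma (p^-1 + 1)).

(* M stands for the integer m * V; the sum is empty for M = 1. *)
Definition approx_distance (R : realType) (D M : nat) (p m n V : R) : R :=
  unit_ball_radius D p / (m * n `^ D%:R^-1 * V) *
  (1 + \sum_(2 <= i < M.+1)
         (n * V / (i%:R - 1) - 1) *
         polylog (- D%:R^-1) ((i%:R - 1) / (n * V))).

(* Main.v *)
Require Import Defs.
From HB Require Import structures.
From mathcomp Require Import all_boot all_order all_algebra.
From mathcomp Require Import all_classical all_reals all_analysis.
From mathcomp Require Import measurable_realfun ring lra.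
Import Order.TTheory GRing.Theory Num.Theory.
Import numFieldNormedType.Exports.
Local Open Scope classical_set_scope.
Local Open Scope ring_scope.

(** Write a = 1/D, so that 0 < a <= 1. On [0, 1[ the integrand equals
    1 + sum_(k >= 1) ((k+1)^a - k^a) x^k, whose coefficients are nonnegative:
    it is nondecreasing and at least 1. With N = nV and M = mV, the
    approximation is a constant times the left Riemann sum of the integrand
    with step 1/N on [0, M/N], which is at most the integral over [0, M/N[.
    Dropping its first term leaves the right Riemann sum on [0, (M-1)/N],
    which is at least the integral there. *)

(** The preimage of a ray [[r, +oo[] is upward closed in [i], hence an interval, and such rays
    generate the Borel sets. *)
Lemma itv_nondecreasing_measurable (R : realType) (i : interval R) (f : R -> R) :
  {in i &, {homo f : x y / x <= y}} -> measurable_fun [set` i] f.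
Proof.
move=> f_nd; apply: (measurability (@RGenCInfty.G R)) => [|/= _ [_] [r] -> <-].
  exact: RGenCInfty.measurableE.
apply: is_interval_measurable => s t /= [si fs] [ti _] u /andP[su ut].
have ui : u \in i by apply: (interval_is_interval si ti); rewrite su ut.
split => //=; move: fs; rewrite /= !in_itv/= !andbT => /le_trans; apply.
exact: f_nd.
Qed.

Lemma integral_const_itvco (R : realType) (a b c : R) : a <= b ->
  (\int[@lebesgue_measure R]_(x in `[a, b[) c%:E = (c * (b - a))%:E)%E.
Proof.
move=> ab; rewrite integral_cst//= lebesgue_measure_itv/= lte_fin.
case: ltP => [_|ba]; first by rewrite -EFinB -EFinM.
have -> : b = a by apply/le_anti; rewrite ab ba.
by rewrite subrr mulr0 mule0.
Qed.

(** * Riemann sums of a nondecreasing function on a half-open interval *)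

Section riemann_sums.
Context {R : realType}.
Variables (b h : R) (f : R -> R).
Hypotheses (h0 : 0 <= h) (f0 : forall x, 0 <= x < b -> 0 <= f x).
Hypothesis f_nd : {in `[0, b[ &, {homo f : x y / x <= y}}.

Local Notation I s t := (\int[@lebesgue_measure R]_(x in `[s%R, t%R[) (f x)%:E)%E.

Let measurable_step s t : 0 <= s -> t <= b -> measurable_fun `[s, t[ (EFin \o f).
Proof.
move=> s0 tb; apply/measurable_EFinP; apply: itv_nondecreasing_measurable.
by apply: sub_in2 f_nd => x; rewrite !in_itv/= => /andP[sx xt]; apply/andP; split;
  [exact: le_trans sx | exact: lt_le_trans tb].
Qed.

Let integral_recr k : k.+1%:R * h <= b ->
  I 0 (k.+1%:R * h) = (I 0 (k%:R * h) + I (k%:R * h) (k.+1%:R * h))%E.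
Proof.
move=> kb.
have kh : k%:R * h <= k.+1%:R * h by rewrite ler_wpM2r// ler_nat.
have k0 : 0 <= k%:R * h by rewrite mulr_ge0.
have UE : `[0, k.+1%:R * h[%classic =
    (`[0, k%:R * h[ `|` `[k%:R * h, k.+1%:R * h[)%classic :> set R.
  by rewrite -itv_bndbnd_setU// bnd_simp.
rewrite {1}UE ge0_integral_setU//.
- by rewrite -UE; exact: measurable_step.
- move=> x; rewrite -UE /= in_itv/= => /andP[x0 xk].
  by rewrite lee_fin f0// x0 (lt_le_trans xk).
- apply/disj_setPLR => x /=; rewrite !in_itv/= => /andP[_ xk].
  by apply/negP; rewrite leNgt xk.
Qed.

(** On each cell [f] is at least its value at the left end. Only left ends are evaluated, so the
    last cell may reach [b], where [f] is not controlled. *)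
Lemma left_riemann_sum_le k : k%:R * h <= b ->
  ((h * \sum_(i < k) f (i%:R * h))%:E <= I 0 (k%:R * h))%E.
Proof.
elim: k => [|k IH] kb.
  by rewrite big_ord0 mulr0 mul0r set_itvco0 integral_set0.
have kh : k%:R * h <= k.+1%:R * h by rewrite ler_wpM2r// ler_nat.
have k0 : 0 <= k%:R * h by rewrite mulr_ge0.
rewrite big_ord_recr/= mulrDr EFinD integral_recr// leeD ?IH ?(le_trans kh)//.
(* For [h > 0] the left end [k%:R * h] is strictly below [b], so [f0] and [f_nd] apply there. *)
have [->|hn0] := eqVneq h 0.
  by rewrite !mulr0 mul0r set_itvco0 integral_set0.
have hgt0 : 0 < h by rewrite lt_neqAle eq_sym hn0.
have kh1 : k%:R * h < k.+1%:R * h by rewrite ltr_pM2r// ltr_nat.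
(* The factor [h] becomes the length of the cell, turning the last term into the integral of a
   constant. *)
have {1}-> : h = k.+1%:R * h - k%:R * h by rewrite -mulrBl -natr1; ring.
rewrite [X in (X%:E <= _)%E]mulrC -integral_const_itvco//.
apply: ge0_le_integral => //.
- by move=> x _; rewrite lee_fin f0// k0 (lt_le_trans kh1).
- exact: measurable_step.
- move=> x /=; rewrite in_itv/= => /andP[kx xk]; rewrite lee_fin.
  apply: f_nd => //; rewrite in_itv/= ?k0 ?(lt_le_trans kh1)//.
  by rewrite (le_trans k0 kx) (lt_le_trans xk).
Qed.

(** On each cell [f] is at most its value at the right end. The last right end [k%:R * h] is itself
    evaluated, hence the strict bound. *)
Lemma right_riemann_sum_ge k : k%:R * h < b ->
  (I 0 (k%:R * h) <= (h * \sum_(i < k) f (i.+1%:R * h))%:E)%E.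
Proof.
elim: k => [|k IH] kb.
  by rewrite big_ord0 mulr0 mul0r set_itvco0 integral_set0.
have kh : k%:R * h <= k.+1%:R * h by rewrite ler_wpM2r// ler_nat.
have k0 : 0 <= k%:R * h by rewrite mulr_ge0.
rewrite big_ord_recr/= mulrDr EFinD integral_recr ?(ltW kb)//.
apply: leeD; first exact/IH/(le_lt_trans kh).
have {3}-> : h = k.+1%:R * h - k%:R * h by rewrite -mulrBl -natr1; ring.
rewrite [X in (_ <= X%:E)%E]mulrC -integral_const_itvco//.
have step0 x : `[k%:R * h, k.+1%:R * h[%classic x -> 0 <= x < b.
  by rewrite /= in_itv/= => /andP[kx xk]; rewrite (le_trans k0 kx) (lt_trans xk).
apply: ge0_le_integral => //.
- by move=> x /step0 xb; rewrite lee_fin f0.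
- by apply: measurable_step => //; exact: ltW.
- move=> x xk; rewrite lee_fin; apply: f_nd.
  + by rewrite in_itv/=; exact: step0.
  + by rewrite in_itv/= kb (le_trans k0).
  + by move: xk; rewrite /= in_itv/= => /andP[_ /ltW].
Qed.

End riemann_sums.

(** * Power series of the integrand *)

Section integrand.
Context {R : realType}.
Implicit Types (a x : R).

Let polylog_sum a x : nat -> R :=
  fun N => \sum_(1 <= k < N) x ^+ k / k%:R `^ (- a).

Lemma sum_natrX_le x N : 0 <= x < 1 ->
  \sum_(1 <= k < N) k%:R * x ^+ k <= (1 - x) ^- 2.
Proof.
move=> /andP[x0 x1].
have x1' : 0 < (1 - x) ^+ 2 by rewrite exprn_gt0// subr_gt0.
rewrite -[leRHS]mul1r ler_pdivlMr//.
case: N => [|N]; first by rewrite big_geq// mul0r.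
(* Multiplying by [(1 - x) ^+ 2] collapses the sum to three terms; the last two add up to at most 0
   because [N%:R * x <= N.+1%:R]. *)
have -> : (\sum_(1 <= k < N.+1) k%:R * x ^+ k) * (1 - x) ^+ 2 =
    x - N.+1%:R * x ^+ N.+1 + N%:R * x ^+ N.+2.
  elim: N => [|N IH]; first by rewrite big_geq// expr1; ring.
  rewrite big_nat_recr//= mulrDl IH -!natr1 !exprS; ring.
rewrite -addrA (le_trans _ (ltW x1))// gerDl addrC subr_le0 [in leLHS]exprS mulrA.
rewrite ler_wpM2r ?exprn_ge0// -natr1.
by have := ler_wpM2l (ler0n R N) (ltW x1); lra.
Qed.

Lemma polylog_cvgn a x : a <= 1 -> 0 <= x < 1 ->
  polylog_sum a x @ \oo --> polylog (- a) x.
Proof.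
move=> a1 xI; have /andP[x0 x1] := xI.
apply: nondecreasing_is_cvgn.
  apply/nondecreasing_seqP => -[|N]; rewrite /polylog_sum; first by rewrite !big_geq.
  by rewrite [leRHS]big_nat_recr//= lerDl divr_ge0 ?exprn_ge0 ?powR_ge0.
exists ((1 - x) ^- 2) => _ [N _ <-]; apply: le_trans (sum_natrX_le x N xI).
rewrite /polylog_sum big_nat_cond [leRHS]big_nat_cond; apply: ler_sum => k /andP[/andP[k1 _] _].
rewrite powRN invrK mulrC ler_wpM2r ?exprn_ge0//.
by rewrite -[leRHS]powRr1// ler_powR// ler1n.
Qed.

(* Only these partial sums are monotone in x: those of
   (x^-1 - 1) * polylog_sum a x carry an extra negative top-degree term. *)
Let integrand_sum a x : nat -> R :=
  fun N => 1 + \sum_(1 <= k < N.+1) (k.+1%:R `^ a - k%:R `^ a) * x ^+ k.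

(** Division by [x] lowers degrees by one, so the first sum takes one more term to reach the same
    degree [N]; its term [k = 1] gives the leading 1. *)
Let integrand_sumE a x N : x != 0 ->
  integrand_sum a x N = x^-1 * polylog_sum a x N.+2 - polylog_sum a x N.+1.
Proof.
move=> x0; rewrite /integrand_sum /polylog_sum.
rewrite [in X in _ * X]big_nat_recl//= mulrDr expr1 powRN powR1 invr1 divr1 mulVf//.
rewrite -addrA; congr (_ + _); rewrite mulr_sumr -sumrB.
by apply: eq_bigr => k _; rewrite !powRN !invrK exprS mulrBl; field.
Qed.

Lemma integrand_cvgn D x : (0 < D)%N -> 0 <= x < 1 ->
  integrand_sum D%:R^-1 x @ \oo --> integrand D x.
Proof.
move=> D0 xI; rewrite /integrand; case: eqVneq => [->|x0].
  suff -> : integrand_sum D%:R^-1 0 = cst 1 by exact: cvg_cst.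
  apply/funext => N; rewrite /integrand_sum big_nat_cond big1 ?addr0// => k.
  by case: k => // k _; rewrite exprS mul0r mulr0.
have -> : integrand_sum D%:R^-1 x = fun N =>
    x^-1 * polylog_sum D%:R^-1 x N.+2 - polylog_sum D%:R^-1 x N.+1.
  by apply/funext => N; exact: integrand_sumE.
rewrite mulrBl mul1r.
have D1 : D%:R^-1 <= 1 :> R by rewrite invf_le1 ?ltr0n// ler1n.
have L := polylog_cvgn _ _ D1 xI.
apply: cvgB; last by rewrite (cvg_shiftS (polylog_sum D%:R^-1 x)).
apply: cvgMr.
by have := L; rewrite -(cvg_shiftn 2); under eq_fun do rewrite addn2.
Qed.

Let coef_ge0 D k : 0 <= k.+1%:R `^ D%:R^-1 - k%:R `^ D%:R^-1 :> R.
Proof.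
by rewrite subr_ge0 ge0_ler_powR ?invr_ge0 ?nnegrE// ler_nat.
Qed.

Lemma integrand_ge1 D x : (0 < D)%N -> 0 <= x < 1 -> 1 <= integrand D x.
Proof.
move=> D0 xI; have L := integrand_cvgn D x D0 xI; have /andP[x0 _] := xI.
rewrite -(cvg_lim _ L)//; apply: limr_ge; first by apply/cvg_ex; eexists; exact: L.
near=> N; rewrite lerDl sumr_ge0// => k _.
by rewrite mulr_ge0 ?coef_ge0 ?exprn_ge0.
Unshelve. all: by end_near. Qed.

Lemma integrand_nondecreasing D : (0 < D)%N ->
  {in `[0, 1[ &, {homo @integrand R D : x y / x <= y}}.
Proof.
move=> D0 x y; rewrite !in_itv/= => xI yI xy.
have Lx := integrand_cvgn D x D0 xI; have Ly := integrand_cvgn D y D0 yI.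
have /andP[x0 _] := xI; have /andP[y0 _] := yI.
rewrite -(cvg_lim _ Lx)// -(cvg_lim _ Ly)//.
apply: ler_lim; [by apply/cvg_ex; eexists; exact: Lx | by apply/cvg_ex; eexists; exact: Ly |].
near=> N; rewrite lerD2l ler_sum// => k _.
by rewrite ler_wpM2l ?coef_ge0// lerXn2r.
Unshelve. all: by end_near. Qed.

End integrand.

(** * The approximation as a scaled Riemann sum *)

Lemma unit_ball_radius_ge0 (R : realType) D (p : R) : 0 <= unit_ball_radius D p.
Proof.
rewrite divr_ge0 ?powR_ge0// mulr_ge0//.
by apply: Rintegral_ge0 => t _; rewrite mulr_ge0 ?powR_ge0 ?expR_ge0.
Qed.

Lemma approx_distanceE (R : realType) (D M N : nat) (p m n V : R) :
  0 < m -> 0 < n -> 0 < V -> (0 < M)%N -> (0 < N)%N -> n * V = N%:R ->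
  approx_distance D M p m n V =
  unit_ball_radius D p / (m * n `^ (D%:R^-1 - 1)) *
  (N%:R^-1 * \sum_(i < M) integrand D (i%:R * N%:R^-1)).
Proof.
move=> m0 n0 V0 M0 N0 nV.
rewrite /approx_distance nV mulrA; congr (_ * _).
  rewrite -nV powRD; last by rewrite (gt_eqF n0) implybT.
  rewrite powRN powRr1 ?(ltW n0)//.
  have na : n `^ D%:R^-1 != 0 by rewrite gt_eqF// powR_gt0.
  by field; rewrite na !gt_eqF.
(* The leading 1 of the bracket is the value of the integrand at 0. *)
case: M M0 => // M _; rewrite big_ord_recl/= mul0r {1}/integrand eqxx; congr (_ + _).
rewrite big_add1/= -[1%N]add1n big_add1 big_mkord; apply: eq_bigr => i _.
rewrite /integrand /bump/= add1n -natr1 addrK.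
rewrite mulf_eq0 invr_eq0 !pnatr_eq0 -[N == 0%N]negbK -lt0n N0 /= invfM invrK.
by rewrite [_^-1 * N%:R]mulrC.
Qed.

Theorem proposition1 (R : realType) (D M N : nat) (p m n V : R)
    (hD : (1 <= D)%N) (hp : 1 <= p)
    (hm : 0 < m) (hn : 0 < n) (hV : 0 < V) (hmn : m <= n)
    (hM : (0 < M)%N) (hN : (0 < N)%N)
    (hmV : m * V = M%:R) (hnV : n * V = N%:R) :
  ((unit_ball_radius D p / (m * n `^ (D%:R^-1 - 1)))%:E *
     \int[@lebesgue_measure R]_(x in `[0%R, (m / n - 1 / (n * V))%R[)
        (integrand D x)%:E
   <= (approx_distance D M p m n V)%:E)%E /\
  ((approx_distance D M p m n V)%:E
   <= (unit_ball_radius D p / (m * n `^ (D%:R^-1 - 1)))%:E *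
     \int[@lebesgue_measure R]_(x in `[0%R, (m / n)%R[)
        (integrand D x)%:E)%E.
Proof.
set c := _ / (m * _).
have c0 : 0 <= c.
  by rewrite divr_ge0 ?unit_ball_radius_ge0// mulr_ge0 ?powR_ge0// ltW.
have h0 : 0 <= N%:R^-1 :> R by rewrite invr_ge0.
have N0 : 0 < N%:R :> R by rewrite ltr0n.
have mE : m / n = M%:R * N%:R^-1.
  by rewrite -hmV -hnV; field; rewrite !gt_eqF.
have MN : M%:R * N%:R^-1 <= 1 :> R by rewrite -mE ler_pdivrMr// mul1r.
have f0 (x : R) : 0 <= x < 1 -> 0 <= integrand D x.
  by move=> xI; exact: le_trans ler01 (integrand_ge1 D x hD xI).
have f_nd := @integrand_nondecreasing R D hD.
rewrite (@approx_distanceE _ D M N)// -/c mE hnV div1r.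
move: c c0 => c c0; rewrite EFinM; split; apply: lee_wpmul2l => //.
  case: M hM MN {hmV mE} => // M _ MN.
  have -> : M.+1%:R * N%:R^-1 - N%:R^-1 = M%:R * N%:R^-1 :> R.
    by rewrite -natr1; ring.
  (* With one step removed the upper limit stays below 1 even when [m = n], so every right end lies
     in [[0, 1[]. *)
  have MN1 : M%:R * N%:R^-1 < 1 :> R.
    by apply: lt_le_trans MN; rewrite ltr_pM2r ?invr_gt0// ltr_nat.
  apply: le_trans (right_riemann_sum_ge 1 _ _ h0 f0 f_nd _ MN1) _.
  rewrite lee_fin ler_wpM2l// big_ord_recl/= lerDr mul0r f0//.
  by rewrite lexx ltr01.
(* Here the upper limit may equal 1, and the integral may be infinite. *)
exact: (left_riemann_sum_le 1).
Qed.
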